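(* Let $\Omega$ be a nonempty open subset of $\mathbb{C}$. Let $\mathcal{S}_{uc}$ be the set of sequences $(f_n)\in H(\Omega)^{\mathbb{N}}$ that converge to $0$ uniformly on every compact subset of $\Omega$, and let $\mathcal{S}_u$ be the set of sequences $(f_n)\in H(\Omega)^{\mathbb{N}}$ that converge to $0$ uniformly on $\Omega$. Let $(K_j)_{j\in\mathbb{N}}$ be an exhaustive sequence of compact subsets of $\Omega$, and endow $\mathcal{S}_{uc}$ with the metric $$D(\mathbf{f},\mathbf{g})=\sum_{j=1}^{\infty}\frac{1}{2^j}\cdot\frac{\|\mathbf{f}-\mathbf{g}\|_{K_j}}{1+\|\mathbf{f}-\mathbf{g}\|_{K_j}},\qquad \text{where } \|\mathbf{f}\|_K:=\sup_{n\in\mathbb{N}}\sup_{z\in K}|f_n(z)| \text{ for } \mathbf{f}=(f_n)\in\mathcal{S}_{uc} \text{ and } K\subset\Omega \text{ compact}.$$ Then the set $\mathcal{S}_{uc}\setminus\mathcal{S}_u$ is residual in $(\mathcal{S}_{uc},D)$; that is, its complement $\mathcal{S}_u$ is of first category in $(\mathcal{S}_{uc},D)$.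
   Context: $H(\Omega)$ is the complex vector space of all holomorphic functions on $\Omega$ (which is not assumed connected), and $H(\Omega)^{\mathbb{N}}$ is the complex vector space (termwise operations) of all sequences of holomorphic functions on $\Omega$. An exhaustive sequence of compact subsets of $\Omega$ means a sequence $(K_j)$ of compact sets with $\Omega=\bigcup_j K_j$, each $K_j$ contained in the interior of $K_{j+1}$, every compact subset of $\Omega$ contained in some $K_j$, and, for each $j$, every connected component of $\mathbb{C}_\infty\setminus K_j$ containing a connected component of $\mathbb{C}_\infty\setminus\Omega$, where $\mathbb{C}_\infty=\mathbb{C}\cup\{\infty\}$ is the Riemann sphere. For $\mathbf{f}\in\mathcal{S}_{uc}$ and $K\subset\Omega$ compact, $\|\mathbf{f}\|_K$ is finite (with the supremum over the empty set taken to be $0$). A set is of first category if it is a countable union of nowhere dense sets. *)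

(* Defs.v *)
From HB Require Import structures.
From mathcomp Require Import all_boot all_order all_algebra.
From mathcomp Require Import all_classical all_reals all_analysis.
From mathcomp.real_closed Require Import complex.
From mathcomp Require Import ring lra.
Set Implicit Arguments.
Unset Strict Implicit.
Unset Printing Implicit Defensive.
Import Order.TTheory GRing.Theory Num.Theory.
Import numFieldNormedType.Exports.
Local Open Scope classical_set_scope.
Local Open Scope ring_scope.

(* The usual topology of the complex plane R[i], as a normed space over
   itself: [derivable f z 1] is then complex differentiability of f at z. *)
HB.instance Definition _ (R : rcfType) := GRing.ComAlgebra.copy R[i] R[i]^o.
HB.instance Definition _ (R : rcfType) := Vector.copy R[i] R[i]^o.
HB.instance Definition _ (R : rcfType) := NormedModule.copy R[i] R[i]^o.

Definition modulus (R : rcfType) (z : R[i]) : R := Normc.normc z.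

Lemma normCE (R : rcfType) (z : R[i]) : `|z| = ((modulus z)%:C)%C.
Proof. by []. Qed.

Section Baire_category.
Context {T : topologicalType}.

Definition nowhere_dense (A : set T) := (closure A)^° = set0.

Definition first_category (A : set T) :=
  exists2 F : (set T)^nat, (forall i, nowhere_dense (F i)) & A = \bigcup_i F i.

Definition residual (A : set T) := first_category (~` A).

End Baire_category.

Section sequences_of_holomorphic_functions.
Context {R : realType}.
Local Notation C := R[i].
Local Notation sphere := (one_point_compactification C).
Implicit Types (Omega : set C) (K : (set C)^nat) (f : nat -> C -> C).

(* H(Omega). A function Omega -> C is represented by its extension by 0 to
   C, so that equality of the representatives is equality on Omega; for Omega
   open the extension does not affect differentiability at points of Omega. *)
Definition holomorphic Omega : set (C -> C) := [set g |
  (forall z, Omega z -> derivable g z 1) /\ (forall z, ~ Omega z -> g z = 0)].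

Definition S_uc Omega : set (nat -> C -> C) := [set f |
  (forall n, holomorphic Omega (f n)) /\
  (forall L, compact L -> L `<=` Omega ->
     {uniform L, f n @[n --> \oo] --> (fun=> 0 : C)})].

Definition S_u Omega : set (nat -> C -> C) := [set f |
  (forall n, holomorphic Omega (f n)) /\
  {uniform Omega, f n @[n --> \oo] --> (fun=> 0 : C)}].

(* Complement in the Riemann sphere of a subset of the plane. *)
Definition sphereC (A : set C) : set sphere := ~` (Some @` A).

Record exhaustive Omega K : Prop := Exhaustive {
  exhaustive_compact : forall j, compact (K j) ;
  exhaustive_bigcup : Omega = \bigcup_j K j ;
  exhaustive_interior : forall j, K j `<=` (K j.+1)^° ;
  exhaustive_absorb : forall L, compact L -> L `<=` Omega ->
    exists j, L `<=` K j ;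
  exhaustive_component : forall j x, sphereC (K j) x ->
    exists2 y, sphereC Omega y &
      connected_component (sphereC Omega) y `<=`
      connected_component (sphereC (K j)) x }.

(* sup set0 = 0, so that seqnorm set0 f = 0. *)
Definition seqnorm (L : set C) f : R :=
  sup [set modulus (f n z) | n in [set: nat] & z in L].

(* K is indexed from 0: K j is the (j + 1)-st compact set, whence its weight
   1 / 2 ^ (j + 1). *)
Definition Dterm K f g (j : nat) : R :=
  (2 ^+ j.+1)^-1 * (seqnorm (K j) (fun n => f n \- g n) /
                    (1 + seqnorm (K j) (fun n => f n \- g n))).

Definition D K f g : R := limn (series (Dterm K f g)).

(* The points of (S_uc, D): the argument hK determines K, hence D, and makes D
   a metric. *)
Record S_uc_space Omega K (hK : exhaustive Omega K) := SUcSpace {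
  S_uc_val :> nat -> C -> C ;
  S_uc_valP : S_uc Omega S_uc_val }.

Section metric.
Variables (Omega : set C) (K : (set C)^nat) (hK : exhaustive Omega K).

Lemma uniform0P (L : set C) f :
  {uniform L, f n @[n --> \oo] --> (fun=> 0 : C)} ->
  forall e : R, 0 < e ->
    \forall n \near \oo, forall z, L z -> modulus (f n z) < e.
Proof.
move=> fL e e0.
have eC : 0 < (e%:C)%C by rewrite ltcR.
have : nbhs ((fun=> 0 : C) : {uniform` L -> C})
    [set h | forall y, L y -> ball (0 : C) (e%:C)%C (h y)].
  apply/uniform_nbhs; exists [set xy | ball xy.1 (e%:C)%C xy.2]; split => //.
  by rewrite -entourage_ballE; exists (e%:C)%C.
move/fL => fLe; rewrite /= nbhs_filterE in fLe; apply: filterS fLe => n H z /H.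
by rewrite -ball_normE /ball_ /= sub0r normrN normCE ltcR.
Qed.

Lemma modulus_ge0 (z : C) : 0 <= modulus z.
Proof. by rewrite -lecR -normCE normr_ge0. Qed.

Lemma modulusD (x y : C) : modulus (x + y) <= modulus x + modulus y.
Proof. exact: le_normcD. Qed.

Lemma modulusN (x : C) : modulus (- x) = modulus x.
Proof. exact: normcN. Qed.

Lemma modulus0 : modulus (0 : C) = 0. Proof. exact: Normc.normc0. Qed.

Lemma holomorphic_bounded (g : C -> C) (L : set C) :
  holomorphic Omega g -> compact L -> L `<=` Omega ->
  exists M, forall z, L z -> modulus (g z) <= M.
Proof.
move=> [gd _] cL LO.
have /compact_near_coveringP gL := cL.
have [|N _ gN] := gL nat \oo (fun n z => modulus (g z) < n%:R).
  move=> z /LO /gd gz.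
  have : {for z, continuous g}.
    by apply: differentiable_continuous; apply/derivable1_diffP.
  move=> /cvgr_dist_lt /(_ _ ltr01) gz1.
  exists ([set y | `|g z - g y| < 1],
          [set n | (Num.truncn (modulus (g z) + 1) < n)%N]).
    by split => //; exists (Num.truncn (modulus (g z) + 1)).+1.
  move=> [y n] [/= gzy nz]; have {}gzy : modulus (g z - g y) < 1.
    by move: gzy; rewrite normCE ltcR.
  apply: (@lt_le_trans _ _ (modulus (g z) + 1)); last first.
    apply: le_trans (ltW (truncnS_gt _)) _.
    by rewrite ler_nat.
  rewrite -[g y](subKr (g z)) (le_lt_trans (modulusD _ _))// ltrD2l.
  by rewrite modulusN.
exists N%:R => z Lz; exact: ltW (gN N (leqnn N) z Lz).
Qed.

Lemma S_uc_bounded f (L : set C) : S_uc Omega f -> compact L -> L `<=` Omega ->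
  exists M, forall n z, L z -> modulus (f n z) <= M.
Proof.
move=> [fh fL] cL LO.
have [N _ fN] := uniform0P (fL _ cL LO) ltr01.
have /choice[b bP] n : exists M, forall z, L z -> modulus (f n z) <= M.
  exact: holomorphic_bounded.
exists (1 + \sum_(i < N) `|b i|) => n z Lz.
have [nN|Nn] := ltnP n N.
  rewrite (le_trans (bP n z Lz))// (le_trans (ler_norm _))//.
  rewrite (bigD1 (Ordinal nN))//= addrCA lerDl addr_ge0// sumr_ge0//.
rewrite (le_trans (ltW (fN n Nn z Lz)))// lerDl sumr_ge0//.
Qed.

Lemma seqnorm_ge0 (L : set C) f : 0 <= seqnorm L f.
Proof.
rewrite /seqnorm; set A := (X in sup X).
have A_ge0 x : A x -> 0 <= x by move=> [n _ [z _ <-]]; exact: modulus_ge0.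
have [Asup|/sup_out->//] := pselect (has_sup A).
have [x Ax] := Asup.1; exact: le_trans (A_ge0 _ Ax) (ub_le_sup Asup.2 Ax).
Qed.

Lemma seqnorm_le (L : set C) f (M : R) : 0 <= M ->
  (forall n z, L z -> modulus (f n z) <= M) -> seqnorm L f <= M.
Proof.
move=> M0 fM; rewrite /seqnorm; set A := (X in sup X).
have [->|A0] := eqVneq A set0; first by rewrite sup0.
by apply: ge_sup; [exact/set0P|move=> _ [n _ [z Lz <-]]; exact: fM].
Qed.

Lemma seqnorm_ub (L : set C) f (M : R) n z :
  (forall n z, L z -> modulus (f n z) <= M) -> L z ->
  modulus (f n z) <= seqnorm L f.
Proof.
move=> fM Lz; apply: ub_le_sup; last by exists n => //; exists z.
by exists M => _ [m _ [y Ly <-]]; exact: fM.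
Qed.

Lemma K_sub j : K j `<=` Omega.
Proof. by rewrite (exhaustive_bigcup hK) => z Kz; exists j. Qed.

Lemma S_ucB_bounded f g j : S_uc Omega f -> S_uc Omega g ->
  exists M, forall n z, K j z -> modulus ((f n \- g n) z) <= M.
Proof.
move=> Sf Sg; have cK := @exhaustive_compact _ _ hK j.
have [M fM] := S_uc_bounded Sf cK (@K_sub j).
have [M' gM'] := S_uc_bounded Sg cK (@K_sub j).
exists (M + M') => n z Kz; rewrite /= (le_trans (modulusD _ _))//.
by rewrite modulusN lerD// ?fM ?gM'.
Qed.

Lemma Dterm_ge0 f g j : 0 <= Dterm K f g j.
Proof.
have H := seqnorm_ge0 (K j) (fun n => f n \- g n).
by rewrite mulr_ge0 ?divr_ge0 ?addr_ge0// invr_ge0 exprn_ge0.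
Qed.

Lemma is_cvg_D f g : cvgn (series (Dterm K f g)).
Proof.
apply: (@series_le_cvg _ _ (geometric 2^-1 2^-1)).
- exact: Dterm_ge0.
- by move=> n; rewrite /= mulr_ge0 ?exprn_ge0 ?invr_ge0.
- move=> n; have H := seqnorm_ge0 (K n) (fun m => f m \- g m).
  rewrite /Dterm /= -exprS -exprVn ler_piMr ?exprn_ge0 ?invr_ge0//.
  by rewrite ler_pdivrMr ?ltr_wpDr// mul1r lerDr.
- by apply: is_cvg_geometric_series; rewrite ger0_norm ?invr_ge0// invf_lt1// ltr1n.
Qed.

Lemma Dxx f : D K f f = 0.
Proof.
rewrite /D (_ : series _ = fun=> 0) ?lim_cst//.
apply/funext => n; rewrite /series /= big1// => j _.
rewrite /Dterm (_ : seqnorm _ _ = 0) ?mul0r ?mulr0//.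
apply/eqP; rewrite eq_le seqnorm_ge0 andbT; apply: seqnorm_le => // m z _.
by rewrite /= subrr modulus0.
Qed.

Lemma D_sym f g : D K f g = D K g f.
Proof.
rewrite /D; suff -> : Dterm K f g = Dterm K g f by [].
apply/funext => j; rewrite /Dterm.
suff -> : seqnorm (K j) (fun n => f n \- g n) =
          seqnorm (K j) (fun n => g n \- f n) by [].
rewrite /seqnorm; congr sup; apply/seteqP.
by split => _ [n _ [z Kz <-]]; exists n => //; exists z => //=;
  rewrite -modulusN opprB.
Qed.

Lemma D_triangle g f h : S_uc Omega f -> S_uc Omega g -> S_uc Omega h ->
  D K f h <= D K f g + D K g h.
Proof.
move=> Sf Sg Sh; rewrite /D -lim_seriesD; [|exact: is_cvg_D..].
apply: lim_series_le; first exact: is_cvg_D.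
  by rewrite seriesD; apply: is_cvgD; exact: is_cvg_D.
move=> j; rewrite /Dterm -[X in _ <= X]/(_ * _ + _ * _) -mulrDr.
apply: ler_wpM2l; first by rewrite invr_ge0 exprn_ge0.
set a := seqnorm _ _; set b := seqnorm _ _; set c := seqnorm _ _.
have a0 : 0 <= a by exact: seqnorm_ge0.
have b0 : 0 <= b by exact: seqnorm_ge0.
have c0 : 0 <= c by exact: seqnorm_ge0.
have abc : a <= b + c.
  have [M fM] := S_ucB_bounded j Sf Sg.
  have [M' gM] := S_ucB_bounded j Sg Sh.
  apply: seqnorm_le => [|n z Kz]; first exact: addr_ge0.
  rewrite (_ : (f n \- h n) z = (f n \- g n) z + (g n \- h n) z).
    rewrite (le_trans (modulusD _ _))// lerD//.
      exact: (seqnorm_ub (f := fun n => f n \- g n) n fM).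
    exact: (seqnorm_ub (f := fun n => g n \- h n) n gM).
  by rewrite /= addrA subrK.
have xE (x : R) : 0 <= x -> x / (1 + x) = 1 - (1 + x)^-1.
  by move=> x0; field; rewrite gt_eqF// ltr_wpDr.
rewrite (@le_trans _ _ ((b + c) / (1 + (b + c))))//.
  by rewrite !xE ?addr_ge0// lerB// lef_pV2 ?posrE ?ltr_wpDr ?addr_ge0// lerD2l.
rewrite mulrDl lerD// ler_wpM2l// lef_pV2 ?posrE ?ltr_wpDr ?addr_ge0// lerD2l.
  by rewrite lerDl.
by rewrite lerDr.
Qed.

Lemma D_eq0 f g : S_uc Omega f -> S_uc Omega g -> D K f g = 0 -> f = g.
Proof.
move=> Sf Sg fg0; apply/funext => n; apply/funext => z.
have [Oz|Oz] := pselect (Omega z); last first.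
  by rewrite (Sf.1 n).2// (Sg.1 n).2.
move: (Oz); rewrite {1}(exhaustive_bigcup hK) => -[j _ Kjz].
have [M fgM] := S_ucB_bounded j Sf Sg.
have tj0 : Dterm K f g j = 0.
  apply/eqP; rewrite eq_le Dterm_ge0 andbT -fg0.
  have nd : nondecreasing_seq (series (Dterm K f g)).
    apply/nondecreasing_seqP => m; rewrite -subr_ge0 seriesSB; exact: Dterm_ge0.
  apply: le_trans (nondecreasing_cvgn_le nd (@is_cvg_D f g) j.+1).
  by rewrite seriesSr lerDr sumr_ge0// => i _; exact: Dterm_ge0.
have s0 := seqnorm_ge0 (K j) (fun n => f n \- g n).
have nj0 : seqnorm (K j) (fun n => f n \- g n) = 0.
  move/eqP: tj0; rewrite /Dterm !mulf_eq0 !invr_eq0 expf_eq0 pnatr_eq0 /= .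
  by case/orP => /eqP// s1; move: s0; rewrite -[seqnorm _ _](addKr 1) s1; lra.
have := seqnorm_ub (f := fun n => f n \- g n) n fgM Kjz.
rewrite nj0 => fg_le0; apply/eqP; rewrite -subr_eq0; apply/eqP.
by apply: Normc.eq0_normc; apply/eqP; rewrite eq_le fg_le0 modulus_ge0.
Qed.

HB.instance Definition _ := gen_eqMixin (S_uc_space hK).
HB.instance Definition _ := gen_choiceMixin (S_uc_space hK).

Let dist (x y : S_uc_space hK) : R := D K x y.

Let distxx x : dist x x = 0. Proof. exact: Dxx. Qed.

Let dist_eq0 x y : dist x y = 0 -> x = y.
Proof.
case: x y => [f Sf] [g Sg] /(D_eq0 Sf Sg) /= fg; subst g.
by rewrite (Prop_irrelevance Sf Sg).
Qed.

Let dist_sym x y : dist x y = dist y x. Proof. exact: D_sym. Qed.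

Let dist_triangle y x z : dist x z <= dist x y + dist y z.
Proof. by apply: D_triangle; exact: S_uc_valP. Qed.

HB.instance Definition _ := @isMetric.Build R (S_uc_space hK) dist
  distxx dist_eq0 dist_sym dist_triangle.

Lemma S_uc_mdistE (x y : S_uc_space hK) : mdist x y = D K x y.
Proof. by []. Qed.

Lemma S_uc_ballE (x : S_uc_space hK) (r : R) :
  ball x r = [set y : S_uc_space hK | D K x y < r].
Proof. by []. Qed.

(* S_u as a subset of the metric space (S_uc, D). *)
Definition S_u_in : set (S_uc_space hK) := [set x | S_u Omega x].

End metric.
End sequences_of_holomorphic_functions.

Arguments S_u_in {R Omega K} hK.

(* Main.v *)
Require Import Defs.
From mathcomp Require Import all_boot all_order all_algebra.
From mathcomp Require Import all_classical all_reals all_analysis.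
From mathcomp.real_closed Require Import complex.
From mathcomp Require Import ring lra.
Set Implicit Arguments.
Unset Strict Implicit.
Unset Printing Implicit Defensive.
Import Order.TTheory GRing.Theory Num.Theory.
Import numFieldNormedType.Exports.
Local Open Scope classical_set_scope.
Local Open Scope ring_scope.

(** Every nonempty open Omega carries an unbounded holomorphic function h: the
    identity if Omega is the whole plane, and 1 / (z - a) for a boundary point
    a otherwise. The sequences with |f_n| <= 1 on Omega for all n >= N form a
    closed set in (S_uc, D), since D-convergence implies pointwise convergence.
    This set has empty interior: adding c h to the N-th term of a sequence
    leaves it, however small c <> 0 is, while the D-distance moved tends to 0
    with c. These sets cover S_u. *)

Section residuality.
Context {R : realType}.
Local Notation C := R[i].
Implicit Types (Omega : set C) (K : nat -> set C) (f g : nat -> C -> C).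

(** * The modulus and the neighbourhoods it defines *)

Lemma modulusM (x y : C) : modulus (x * y) = modulus x * modulus y.
Proof. exact: Normc.normcM. Qed.

Lemma modulusV (x : C) : modulus x^-1 = (modulus x)^-1.
Proof. exact: Normc.normcV. Qed.

Lemma modulus_gt0 (x : C) : x != 0 -> 0 < modulus x.
Proof.
move=> x0; rewrite lt_neqAle modulus_ge0 andbT eq_sym.
by apply: contra_neq x0; exact: Normc.eq0_normc.
Qed.

Lemma modulus_real (t : R) : modulus (t%:C)%C = `|t|.
Proof. by rewrite /modulus /= expr0n /= addr0 sqrtr_sqr. Qed.

(** The norm on [C] is [C]-valued, so a ball has a complex radius [e]; being positive it is real,
    and its real part serves as radius. *)
Lemma nbhs_modulus (z : C) (A : set C) : nbhs z A ->
  exists2 e : R, 0 < e & forall y, modulus (z - y) < e -> A y.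
Proof.
move=> /nbhs_ballP[e /= e0 eA].
have eE : e = ((complex.Re e)%:C)%C by rewrite RRe_real// gtr0_real.
exists (complex.Re e); first by rewrite -ltcR -eE.
move=> y zy; apply: eA; rewrite -ball_normE /ball_ /= normCE eE.
by rewrite ltcR.
Qed.

(** * An unbounded holomorphic function *)

(** Take for [t0] the infimum of the parameters t >= 0 whose point on the segment lies outside
    [Omega]. *)
Lemma segment_exit_point Omega (z w : C) : open Omega -> Omega z -> ~ Omega w ->
  exists2 t0 : R, ~ Omega (z + (t0%:C)%C * (w - z)) &
    0 < t0 /\
    forall t, 0 <= t -> t < t0 -> Omega (z + (t%:C)%C * (w - z)).
Proof.
move=> oO Oz Ow.
pose g (t : R) := z + (t%:C)%C * (w - z).
pose A : set R := [set t | 0 <= t /\ ~ Omega (g t)].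
have A1 : A 1 by split => //; rewrite /g mul1r addrC subrK.
have wz0 : 0 < modulus (w - z).
  by apply: modulus_gt0; rewrite subr_eq0; apply: contra_notN Ow => /eqP ->.
have Alb : has_lbound A by exists 0 => t [].
have Ainf : has_inf A by split => //; exists 1.
have i0 : 0 <= inf A by apply: lb_le_inf; [exists 1|move=> t []].
have Oi : ~ Omega (g (inf A)).
  move=> Og.
  have [e e0 eO] := nbhs_modulus (open_nbhs_nbhs (conj oO Og)).
  (* A parameter step s moves the point by s |w - z|, so a step below e / |w - z| stays in the ball
     of radius [e] inside [Omega]. *)
  have [t At tlt] := inf_adherent (divr_gt0 e0 wz0) Ainf.
  apply: At.2; apply: eO.
  have -> : g (inf A) - g t = ((inf A - t)%:C)%C * (w - z).
    by rewrite /g rmorphB /=; ring.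
  rewrite modulusM modulus_real -ltr_pdivlMr// distrC ger0_norm; first lra.
  by rewrite subr_ge0; apply: ge_inf.
exists (inf A) => //; split.
  rewrite lt_neqAle i0 andbT; apply/eqP => i0'; apply: Oi.
  by rewrite /g -i0' mul0r addr0.
move=> t t0 ti; apply: contrapT => Ot.
have : inf A <= t by apply: ge_inf.
by rewrite leNgt ti.
Qed.

(** Since [Omega] is open, cutting off by 0 outside does not change [h] near a point of [Omega]. *)
Lemma holomorphic_extension Omega (h : C -> C) : open Omega ->
  (forall z, Omega z -> derivable h z 1) ->
  holomorphic Omega (fun z => if `[< Omega z >] then h z else 0).
Proof.
move=> oO hd; split=> z Oz; last by rewrite asboolF.
apply: (@near_eq_derivable _ _ _ h); last exact: hd.
have : nbhs z Omega by exact: open_nbhs_nbhs.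
by apply: filterS => y Oy; rewrite asboolT.
Qed.

Lemma holomorphicDZ Omega (g h : C -> C) (c : C) :
  holomorphic Omega g -> holomorphic Omega h ->
  holomorphic Omega (fun z => g z + c * h z).
Proof.
move=> [gd g0] [hd h0]; split=> z Oz; last by rewrite g0// h0// mulr0 addr0.
apply: (@derivableD _ _ _ g (fun z => c * h z)); first exact: gd.
by apply: derivableZ; exact: hd.
Qed.

Lemma unbounded_holomorphic Omega : open Omega -> Omega !=set0 ->
  exists2 h, holomorphic Omega h &
    forall M : R, exists2 z, Omega z & M < modulus (h z).
Proof.
move=> oO [z0 Oz0].
have [OT|/existsNP[w Ow]] := pselect (forall w, Omega w).
  exists (fun z => if `[< Omega z >] then z else 0).
    by apply: holomorphic_extension => // z _; exact: derivable_id.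
  move=> M; exists ((`|M| + 1)%:C)%C => //; rewrite asboolT//.
  by rewrite modulus_real (lt_le_trans _ (ler_norm _))// ltr_pwDr// ler_norm.
have [t0 Oa [t0_gt0 tO]] := segment_exit_point oO Oz0 Ow.
set a := (X in ~ Omega X) in Oa.
have wz0 : 0 < modulus (w - z0).
  by apply: modulus_gt0; rewrite subr_eq0; apply: contra_notN Ow => /eqP ->.
exists (fun z => if `[< Omega z >] then (z - a)^-1 else 0).
  apply: holomorphic_extension => // z Oz; apply: derivableV.
    by rewrite subr_eq0; apply: contra_notN Oa => /eqP <-.
  by apply: derivableB; [exact: derivable_id|exact: derivable_cst].
move=> M.
(* Stepping back by [d] from the exit point [a] stays on the part of the segment inside [Omega], at
   distance d |w - z0| <= 1 / (|M| + 1) from [a]. *)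
pose d := Num.min t0 (((`|M| + 1) * modulus (w - z0))^-1).
have M0 : 0 < `|M| + 1 by rewrite ltr_wpDl.
have d0 : 0 < d by rewrite lt_min t0_gt0 invr_gt0 mulr_gt0.
have dt0 : d <= t0 by rewrite ge_min lexx.
have dM : d <= ((`|M| + 1) * modulus (w - z0))^-1 by rewrite ge_min lexx orbT.
have Oz := tO (t0 - d); set z := (X in _ -> _ -> Omega X) in Oz.
have {}Oz : Omega z by apply: Oz; lra.
exists z => //; rewrite asboolT// modulusV.
have -> : z - a = - ((d%:C)%C * (w - z0)) by rewrite /z /a rmorphB /=; ring.
rewrite modulusN modulusM modulus_real gtr0_norm//.
apply: (@lt_le_trans _ _ (`|M| + 1)).
  by rewrite ltr_pwDr// ler_norm.
rewrite -[leLHS]invrK lef_pV2 ?posrE ?invr_gt0 ?mulr_gt0//.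
by rewrite -ler_pdivlMr// -invfM.
Qed.

(** * Estimates for the metric *)

Section exhaustion.
Variables (Omega : set C) (K : nat -> set C) (hK : exhaustive Omega K).

Lemma Dterm_le_D f g j : Dterm K f g j <= D K f g.
Proof.
have nd : nondecreasing_seq (series (Dterm K f g)).
  by apply/nondecreasing_seqP => m; rewrite -subr_ge0 seriesSB Dterm_ge0.
apply: le_trans (nondecreasing_cvgn_le nd (@is_cvg_D _ K f g) j.+1).
by rewrite seriesSr lerDr sumr_ge0// => i _; exact: Dterm_ge0.
Qed.

(** The [j]-th term alone is at most [D], and s / (1 + s) increases with s, so the bound on the term
    gives one on the seminorm over [K j]. *)
Lemma D_lt_modulus f g j n z (e : R) : S_uc Omega f -> S_uc Omega g ->
  K j z -> 0 < e -> D K f g < (2 ^+ j.+1)^-1 * (e / (1 + e)) ->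
  modulus (f n z - g n z) < e.
Proof.
move=> Sf Sg Kz e0 De.
have [M fgM] := S_ucB_bounded hK j Sf Sg.
have := @seqnorm_ub _ (K j) (fun n => f n \- g n) M n z fgM Kz.
move/le_lt_trans; apply.
have := le_lt_trans (Dterm_le_D f g j) De.
rewrite /Dterm ltr_pM2l ?invr_gt0 ?exprn_gt0//.
set s := seqnorm _ _.
have s0 : 0 <= s by exact: seqnorm_ge0.
rewrite ltr_pdivrMr; last lra.
rewrite mulrAC ltr_pdivlMr; last lra.
lra.
Qed.

(** The first [J] terms contribute at most [e] times their weights; the weights of the others sum to
    2^-J. *)
Lemma D_le_split f g (J : nat) (e : R) : 0 <= e ->
  (forall j n z, (j < J)%N -> K j z -> modulus (f n z - g n z) <= e) ->
  D K f g <= e + 2^-1 ^+ J.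
Proof.
move=> e0 fge.
pose v (n : nat) : R := 2^-1 ^+ n.
have vS n : v n = 2 * v n.+1 by rewrite /v exprS; field.
have v0 n : 0 <= v n by rewrite exprn_ge0// invr_ge0.
have tE j : Dterm K f g j = v j.+1 * (seqnorm (K j) (fun n => f n \- g n) /
    (1 + seqnorm (K j) (fun n => f n \- g n))) by rewrite /v exprVn.
have t1 j : Dterm K f g j <= v j.+1.
  rewrite tE ler_piMr//.
  have s0 := seqnorm_ge0 (K j) (fun n => f n \- g n).
  by rewrite ler_pdivrMr; lra.
have te j : (j < J)%N -> Dterm K f g j <= v j.+1 * e.
  move=> jJ; rewrite tE ler_wpM2l//.
  have s0 := seqnorm_ge0 (K j) (fun n => f n \- g n).
  have se : seqnorm (K j) (fun n => f n \- g n) <= e.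
    by apply: seqnorm_le => // n z; exact: (fge j n z jJ).
  rewrite ler_pdivrMr; last lra.
  by rewrite (le_trans se)// mulrDr mulr1 lerDl mulr_ge0.
(* By [vS] each weight is v j.+1 = v j - v j.+1, so sums of weights telescope. *)
have le_small n : (n <= J)%N -> series (Dterm K f g) n <= e * (1 - v n).
  elim: n => [_|n ih nJ].
    by rewrite /series /= big_geq// /v expr0 subrr mulr0.
  rewrite seriesSr; have := ih (ltnW nJ); have := te _ nJ; have := vS n.
  by move=> ->; lra.
have le_large n : series (Dterm K f g) (J + n)%N <= e + (v J - v (J + n)%N).
  elim: n => [|n ih].
    have := le_small _ (leqnn J); rewrite addn0 => le_J.
    by apply: le_trans le_J _; have := mulr_ge0 e0 (v0 J); lra.
  by rewrite addnS seriesSr; have := t1 (J + n)%N; have := vS (J + n)%N; lra.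
apply: limr_le; first exact: is_cvg_D.
exists J => // n /= Jn; rewrite -(subnKC Jn).
by apply: le_trans (le_large _) _; have := v0 (J + (n - J))%N; rewrite /v; lra.
Qed.

Lemma K_subset_le i j : (i <= j)%N -> K i `<=` K j.
Proof.
move=> /subnKC <-; elim: (j - i)%N => [|n ih]; first by rewrite addn0.
rewrite addnS => z /ih Kz; apply: interior_subset.
exact: (exhaustive_interior hK).
Qed.

(** * Small perturbations of one term *)

Definition add_at f (N : nat) (c : C) (h : C -> C) : nat -> C -> C :=
  fun n => if n == N then (fun z => f n z + c * h z) else f n.

Lemma S_uc_add_at f N c h : S_uc Omega f -> holomorphic Omega h ->
  S_uc Omega (add_at f N c h).
Proof.
move=> [fh fL] hh; split=> [n|L cL LO].
  by rewrite /add_at; case: eqP => // _; exact: holomorphicDZ.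
(* The two sequences agree beyond index [N]. *)
apply: cvg_trans (fL L cL LO); apply: near_eq_cvg.
by exists N.+1 => // n /= Nn; rewrite /add_at gtn_eqF.
Qed.

Lemma D_add_at_small f N h (r : R) : 0 < r -> holomorphic Omega h ->
  exists2 c : R, 0 < c & D K f (add_at f N (c%:C)%C h) < r.
Proof.
move=> r0 hh.
have r2 : 0 < r / 2 by rewrite divr_gt0.
have [J _ Jr] : \forall J \near \oo, 2^-1 ^+ J < r / 2.
  have : @GRing.exp R 2^-1 @ \oo --> 0.
    by apply: cvg_expr; rewrite ger0_norm ?invr_ge0// invf_lt1// ltr1n.
  move=> /cvgr_dist_lt /(_ _ r2); apply: filterS => n.
  by rewrite sub0r normrN ger0_norm// exprn_ge0// invr_ge0.
have {}Jr := Jr J (leqnn J).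
(* As the [K j] are nested, a bound on [K J] serves for all j < J. The factor c = e / (|M| + 1) then
   keeps |c h| <= e = r / 4 there, and r / 4 + 2^-J < r. *)
have [M hM] := holomorphic_bounded hh (@exhaustive_compact _ _ _ hK J) (@K_sub _ _ _ hK _).
have M0 : 0 < `|M| + 1 by rewrite ltr_wpDl.
pose e := r / 4; have e0 : 0 < e by rewrite divr_gt0.
have c0 : 0 < e / (`|M| + 1) by rewrite divr_gt0.
exists (e / (`|M| + 1)) => //.
apply: (@le_lt_trans _ _ (e + 2^-1 ^+ J)); last by rewrite /e; lra.
apply: D_le_split; first exact: ltW.
move=> j n z jJ Kz; rewrite /add_at.
case: eqP => _; last by rewrite subrr modulus0 ltW.
rewrite opprD addNKr modulusN modulusM modulus_real gtr0_norm//.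
rewrite mulrAC ler_pdivrMr// ler_wpM2l ?(ltW e0)//.
rewrite (le_trans (hM z (K_subset_le (ltnW jJ) Kz)))//.
by rewrite (le_trans (ler_norm M))// lerDl.
Qed.

(** * Nowhere dense sets covering [S_u] *)

Definition tail_le1 (N : nat) : set (S_uc_space hK) :=
  [set x | forall n z, (N <= n)%N -> Omega z -> modulus (S_uc_val x n z) <= 1].

Lemma closed_tail_le1 N : closure (tail_le1 N) `<=` tail_le1 N.
Proof.
move=> x xcl n z Nn Oz; rewrite leNgt; apply/negP => x1.
have e0 : 0 < modulus (S_uc_val x n z) - 1 by rewrite subr_gt0.
set e := _ - 1 in e0.
move: (Oz); rewrite {1}(exhaustive_bigcup hK) => -[j _ Kz].
(* Within this radius of [x] the value at [n], [z] changes by less than the excess [e] of its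
   modulus over 1, hence keeps modulus above 1. *)
have r0 : 0 < (2 ^+ j.+1)^-1 * (e / (1 + e)).
  by rewrite mulr_gt0 ?invr_gt0 ?exprn_gt0// divr_gt0// addr_gt0.
have [y [yN]] := xcl _ (nbhsx_ballx x _ r0).
rewrite S_uc_ballE /= => /(D_lt_modulus n (S_uc_valP x) (S_uc_valP y) Kz e0).
move=> xy; have y1 := yN n z Nn Oz.
have := modulusD (S_uc_val x n z - S_uc_val y n z)
  (S_uc_val y n z).
by rewrite subrK; move: xy; rewrite /e; lra.
Qed.

Lemma nowhere_dense_tail_le1 N : open Omega -> Omega !=set0 ->
  nowhere_dense (tail_le1 N).
Proof.
move=> oO O0; rewrite /nowhere_dense -subset0 => x.
move=> /(nbhs_ballP (M := S_uc_space hK)) [r /= r0 xr].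
have xN : tail_le1 N x by apply: closed_tail_le1; apply: xr; exact: ballxx.
have [h hh hoo] := unbounded_holomorphic oO O0.
have [c c0 Dc] := D_add_at_small x N r0 hh.
pose y := SUcSpace hK (S_uc_add_at N (c%:C)%C (S_uc_valP x) hh).
have yN : tail_le1 N y.
  by apply: closed_tail_le1; apply: xr; rewrite S_uc_ballE.
(* Here |c h z| > 2, yet c h z is the difference of the [N]-th terms of [y] and [x] at [z], both of
   modulus at most 1. *)
have [z Oz hz] := hoo (2 / c).
have := yN N z (leqnn _) Oz; have := xN N z (leqnn _) Oz.
rewrite /y /= /add_at eqxx; set a := S_uc_val _ _ _ => a1 ach1.
have := modulusD (a + (c%:C)%C * h z) (- a).
rewrite addrAC subrr add0r modulusN modulusM modulus_real gtr0_norm//.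
by move: hz; rewrite ltr_pdivrMr//; lra.
Qed.

End exhaustion.
End residuality.

Theorem mainTheorem5 (R : realType) (Omega : set R[i])
  (Omega_open : open Omega) (Omega_neq0 : Omega !=set0)
  (K : nat -> set R[i]) (hK : exhaustive Omega K) :
  residual ([set: S_uc_space hK] `\` S_u_in hK).
Proof.
(* Intersecting with [S_u_in hK] makes the union equal to it, as [first_category] requires, and
   keeps the sets nowhere dense. *)
exists (fun N => S_u_in hK `&` tail_le1 (hK := hK) N).
  move=> N; rewrite /nowhere_dense -subset0.
  rewrite -(nowhere_dense_tail_le1 hK N Omega_open Omega_neq0).
  by apply: interiorS; apply: closureS; exact: subIsetr.
rewrite setTD setCK; apply/seteqP; split=> [x Sx|x [N _ []]//].
have [N _ xN] := uniform0P Sx.2 ltr01.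
by exists N => //; split => // n z Nn Oz; exact: ltW (xN n Nn z Oz).
Qed.
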